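(* Let $G=(V,E)$ be a finite simple undirected graph and $k\in\mathbb{N}$. Then (number of $2k$-edge-connected subgraphs of $G$) $\le$ (number of $k$-arc-strong orientations of $G$) $\le$ (number of $k$-edge-connected subgraphs of $G$).
   Context: A subgraph of $G$ means a spanning subgraph $(V,X)$ with $X\subseteq E$ (so subgraphs correspond to subsets of $E$). A graph is $k$-edge-connected if it remains connected whenever fewer than $k$ edges are removed. A digraph is $k$-arc-strong if for every pair of vertices $u,v$ there are $k$ arc-disjoint directed paths from $u$ to $v$. An orientation of $G$ assigns a direction to each edge of $G$. *)

(* Defs.v *)
(* A finite simple undirected graph is an irreflexive symmetric
   relation e on a finType T; a spanning subgraph is its set of edges, each
   edge being the unordered pair [set x; y]. *)
From mathcomp Require Import all_boot.

Set Implicit Arguments.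
Unset Strict Implicit.
Unset Printing Implicit Defensive.

Section Defs.

Variable T : finType.
Implicit Types (e : rel T) (X F : {set {set T}}) (A : {set T * T}).
Implicit Types (u v : T) (p : seq T) (k : nat).

Definition edges e : {set {set T}} :=
  [set [set q.1; q.2] | q : T * T & e q.1 q.2].

Definition adj X : rel T := [rel x y | [set x; y] \in X].

Definition connected_graph X : bool :=
  [forall x, forall y, connect (adj X) x y].

Definition edge_connected k X : bool :=
  [forall F : {set {set T}},
     (F \subset X) && (#|F| < k) ==> connected_graph (X :\: F)].

(* An orientation is recorded as its set of arcs (tail, head): exactly one of
   (x, y) and (y, x) for each edge xy, and no other arc. *)
Definition orientation e A : bool :=
  [forall x, forall y,
     if e x y then ((x, y) \in A) (+) ((y, x) \in A) else (x, y) \notin A].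

(* The vertex sequence of the path is u :: p. *)
Definition dipath A u v p : bool :=
  [&& path [rel x y | (x, y) \in A] u p, last u p == v & uniq (u :: p)].

Definition arcs u p : seq (T * T) := zip (u :: p) p.

(* The paths range over sequences of at most #|T| vertices only to make the
   predicate boolean: a path does not repeat vertices, so nothing is lost. *)
Definition arc_strong k A : bool :=
  [forall u, forall v, (u != v) ==>
     [exists P : {ffun 'I_k -> #|T|.-bseq T},
        [forall i, dipath A u v (P i)] &&
        [forall i, forall j, (i != j) ==>
           [disjoint arcs u (P i) & arcs u (P j)]]]].

Definition edge_connected_subgraphs e k : {set {set {set T}}} :=
  [set X : {set {set T}} | (X \subset edges e) && edge_connected k X].

Definition arc_strong_orientations e k : {set {set T * T}} :=
  [set A : {set T * T} | orientation e A && arc_strong k A].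

End Defs.

(* Main.v *)
Require Import Defs.
From mathcomp Require Import all_boot zify.

(** After fixing a reference orientation, orientations are subsets of its arcs,
    and Pajor's inequality bounds the size of a set system by the number of sets
    it shatters.  If the [k]-arc-strong orientations shatter [X], then orienting
    [X] from one side of a cut to the other shows that the edges outside [X] form
    a [k]-edge-connected subgraph; this is the upper bound.  For the lower bound,
    apply the inequality to the orientations that are not [k]-arc-strong: they
    shatter no [2k]-edge-connected subgraph [Y], since by Nash-Williams [Y] has a
    [k]-arc-strong orientation and every orientation extending it is
    [k]-arc-strong.  Nash-Williams' theorem is proved by Lovász' splitting off,
    and Menger's theorem, which turns cuts into paths, by augmenting flows. *)

Set Implicit Arguments.
Unset Strict Implicit.
Unset Printing Implicit Defensive.

(** * Pajor's inequality *)

Section Shattering.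

Variable I : finType.
Implicit Types (S : {set {set I}}) (X Y Z : {set I}).

Definition shattered S X : bool :=
  [forall Y : {set I}, (Y \subset X) ==> [exists Z in S, Z :&: X == Y]].

Lemma shatteredP S X :
  reflect (forall Y, Y \subset X -> exists2 Z, Z \in S & Z :&: X = Y)
          (shattered S X).
Proof.
apply: (iffP forallP) => [sh Y YX|sh Y].
  by have /implyP/(_ YX)/exists_inP[Z ZS /eqP ZX] := sh Y; exists Z.
apply/implyP => /sh[Z ZS ZX]; apply/exists_inP; exists Z => //.
exact/eqP.
Qed.

Lemma shattered_subset S X Z0 :
  {in S, forall Z, Z \subset Z0} -> shattered S X -> X \subset Z0.
Proof.
move=> sub /shatteredP/(_ X (subxx _))[Z /sub ZZ0 <-].
exact: subset_trans (subsetIl _ _) ZZ0.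
Qed.

(** Induction on [#|S|]. An element [i] on which two members differ splits [S] into two smaller
    families, and [i] is removed from the members that contain it. A set shattered by one family is
    shattered by [S]; a set shattered by both remains shattered by [S] after [i] is added. *)
Theorem card_le_shattered S : #|S| <= #|[set X | shattered S X]|.
Proof.
have [n] := ubnP #|S|; elim: n S => // n IH S ltSn.
have [S1|] := leqP #|S| 1.
  have [->|[Z ZS]] := set_0Vmem S; first by rewrite cards0.
  apply: leq_trans S1 _; apply/card_gt0P; exists set0; rewrite inE.
  apply/shatteredP => Y; rewrite subset0 => /eqP ->.
  by exists Z => //; rewrite setI0.
case/card_gt1P => Z1 [Z2 [Z1S Z2S /eqP neqZ]].
have [i iZ] : exists i, (i \in Z1) (+) (i \in Z2).
  apply/existsP; apply: contraT => /existsPn eqZ.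
  by case: neqZ; apply/setP => i; have := eqZ i; case: (i \in Z1); case: (i \in Z2).
pose S0 := [set Z in S | i \notin Z]; pose Si := [set Z in S | i \in Z].
pose S1 : {set {set I}} := [set Z :\ i | Z in Si].
have cS : #|S| = #|S0| + #|Si|.
  rewrite -(cardsID Si S) addnC; congr (_ + _); apply: eq_card => Z.
    by rewrite !inE; case: (Z \in S); rewrite ?andbT ?andbF.
  by rewrite !inE; case: (Z \in S).
have cS1 : #|S1| = #|Si|.
  apply: card_in_imset => A B; rewrite !inE => /andP[_ iA] /andP[_ iB] AB.
  by rewrite -(setD1K iA) AB setD1K.
have S0_gt0 : 0 < #|S0|.
  apply/card_gt0P; move: iZ; case: (boolP (i \in Z1)) => /= i1 i2.
    by exists Z2; rewrite inE Z2S.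
  by exists Z1; rewrite inE Z1S.
have Si_gt0 : 0 < #|Si|.
  apply/card_gt0P; move: iZ; case: (boolP (i \in Z1)) => /= i1 i2.
    by exists Z1; rewrite inE Z1S.
  by exists Z2; rewrite inE Z2S.
have le0 : #|S0| <= #|[set X | shattered S0 X]|.
  by apply: IH; move: ltSn; rewrite cS ltnS; apply: leq_trans; rewrite -addn1 leq_add2l.
have le1 : #|S1| <= #|[set X | shattered S1 X]|.
  by apply: IH; move: ltSn; rewrite cS1 cS ltnS; apply: leq_trans; rewrite -add1n leq_add2r.
pose U : {set {set I}} := [set X | shattered S0 X] :|: [set X | shattered S1 X].
pose J : {set {set I}} := [set X | shattered S0 X] :&: [set X | shattered S1 X].
have i0 X : shattered S0 X -> i \notin X.
  move=> sh; have sub : {in S0, forall Z : {set I}, Z \subset [set~ i]}.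
    move=> Z; rewrite inE => /andP[_ iZ']; apply/subsetP => x xZ.
    by rewrite !inE; apply: contraNneq iZ' => <-.
  have /subsetP XS := shattered_subset sub sh.
  by apply/negP => /XS; rewrite !inE eqxx.
have i1 X : shattered S1 X -> i \notin X.
  move=> sh; have sub : {in S1, forall Z : {set I}, Z \subset [set~ i]}.
    move=> Z /imsetP[Z' _ ->]; apply/subsetP => x.
    by rewrite !inE => /andP[].
  have /subsetP XS := shattered_subset sub sh.
  by apply/negP => /XS; rewrite !inE eqxx.
have shU X : X \in U -> shattered S X.
  rewrite !inE => /orP[] sh; apply/shatteredP => Y YX.
    have [Z] := shatteredP _ _ sh Y YX.
    by rewrite inE => /andP[ZS _] <-; exists Z.
  have [Z /imsetP[Z' + ->] <-] := shatteredP _ _ sh Y YX.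
  rewrite inE => /andP[Z'S _]; exists Z' => //.
  apply/setP => x; rewrite !inE; case: eqP => //= ->.
  by rewrite (negPf (i1 _ sh)) andbF.
have shJ X : X \in J -> shattered S (i |: X).
  rewrite !inE => /andP[sh0 sh1]; apply/shatteredP => Y YX.
  have YX' : Y :\ i \subset X by rewrite subDset.
  have [iY|iY] := boolP (i \in Y).
    have [Z /imsetP[Z' + ->] eqY] := shatteredP _ _ sh1 _ YX'.
    rewrite inE => /andP[Z'S iZ']; exists Z' => //.
    rewrite -(setD1K iY) -eqY; apply/setP => x; rewrite !inE.
    by case: eqP => [->|]; rewrite ?iZ'.
  have [Z] := shatteredP _ _ sh0 _ YX'.
  rewrite inE => /andP[ZS iZ'] eqY; exists Z => //.
  apply/setP => x; have /setP/(_ x) := eqY; rewrite !inE.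
  by case: eqP => [->|]; rewrite ?(negPf iZ') ?(negPf iY).
have cJ : #|[set i |: X | X in J]| = #|J|.
  apply: card_in_imset => A B; rewrite !inE => /andP[/i0 iA _] /andP[/i0 iB _] AB.
  by rewrite -(setU1K iA) AB setU1K.
(* The two families are disjoint, since no member of [U] contains [i], so this union has
   [#|U| + #|J|] members, which is the sum of the two counts given by induction. *)
have : #|U :|: [set i |: X | X in J]| <= #|[set X | shattered S X]|.
  apply: subset_leq_card; apply/subsetP => X; rewrite inE.
  by case/orP => [/shU|/imsetP[X' /shJ sh ->]]; rewrite inE.
rewrite cardsU cJ [_ :&: _](_ : _ = set0) ?cards0; last first.
  apply/setP => X; rewrite [RHS]inE; apply/negbTE/negP; rewrite inE.
  case/andP => XU /imsetP[X' _ eqX]; move: XU; rewrite !inE.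
  by case/orP => [/i0|/i1]; rewrite eqX !inE eqxx.
have : #|U| + #|J| = #|[set X | shattered S0 X]| + #|[set X | shattered S1 X]|.
  by rewrite cardsUI.
lia.
Qed.

End Shattering.

(** * Nash-Williams' orientation theorem *)

Section Multigraphs.

Variable T : finType.
Implicit Types (s t a : seq (T * T)) (p q : T * T) (U V W X : {set T}).
Implicit Types (x y z v : T).

Definition swap p : T * T := (p.2, p.1).

Definition crosses U p := (p.1 \in U) (+) (p.2 \in U).
Definition leaves U p := (p.1 \in U) && (p.2 \notin U).
Definition deg s U := count (crosses U) s.
Definition out s U := count (leaves U) s.

(* [s] and [t] are the same undirected multigraph: a list of arcs is read as a
   list of edges, so [ueq s a] also says that [a] is an orientation of [s].
   Loops are allowed, since splitting off creates them; they cross no cut. *)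
Definition ueq s t := forall P : pred (T * T),
  (forall p, P (swap p) = P p) -> count P s = count P t.

Lemma swapK : involutive swap. Proof. by case. Qed.

Lemma ueq_sym s t : ueq s t -> ueq t s.
Proof. by move=> st P Ps; rewrite st. Qed.

Lemma ueq_trans t s r : ueq s t -> ueq t r -> ueq s r.
Proof. by move=> st tr P Ps; rewrite st // tr. Qed.

Lemma ueq_cons p s t : ueq s t -> ueq (p :: s) (p :: t).
Proof. by move=> st P Ps /=; rewrite st. Qed.

Lemma ueq_rem p s : p \in s -> ueq s (p :: rem p s).
Proof. by move=> /perm_to_rem/permP ps P _; apply: ps. Qed.

Lemma ueq_swap p s : ueq (p :: s) (swap p :: s).
Proof. by move=> P Ps /=; rewrite Ps. Qed.

Lemma ueq_mem p s t : ueq (p :: s) t -> (p \in t) || (swap p \in t).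
Proof.
have Ps : forall r, ((swap r == p) || (swap r == swap p)) =
                    ((r == p) || (r == swap p)).
  by move=> r; rewrite (inj_eq (can_inj swapK)) (can2_eq swapK swapK) orbC.
move=> /(_ (fun r => (r == p) || (r == swap p)) Ps) /= => /esym.
rewrite eqxx /= => cnt.
have /hasP[r rt /orP[/eqP <-|/eqP <-]] :
    has (fun r => (r == p) || (r == swap p)) t by rewrite has_count cnt.
  by rewrite rt.
by rewrite rt orbT.
Qed.

Lemma crosses_swap U p : crosses U (swap p) = crosses U p.
Proof. by rewrite /crosses addbC. Qed.

Lemma deg_ueq s t U : ueq s t -> deg s U = deg t U.
Proof. by apply; apply: crosses_swap. Qed.

Lemma degC s U : deg s (~: U) = deg s U.
Proof.
by apply: eq_count => p; rewrite /crosses !inE; do 2!case: (_ \in _).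
Qed.

Lemma deg_out s U : deg s U = out s U + out s (~: U).
Proof.
rewrite /deg /out; elim: s => //= p s ->; rewrite /crosses /leaves !inE.
by do 2!case: (_ \in U) => /=; lia.
Qed.

(** Submodularity of the cut function. This and the next two inequalities are checked edge by edge,
    over the positions of the two ends. *)
Lemma degI_degU s X Y : deg s (X :&: Y) + deg s (X :|: Y) <= deg s X + deg s Y.
Proof.
rewrite /deg; elim: s => //= p s; rewrite /crosses !inE.
by do 4!case: (_ \in _) => /=; lia.
Qed.

Lemma degD_degD s X Y : deg s (X :\: Y) + deg s (Y :\: X) <= deg s X + deg s Y.
Proof.
rewrite /deg; elim: s => //= p s; rewrite /crosses !inE.
by do 4!case: (_ \in _) => /=; lia.
Qed.

(** The four sets on the left are disjoint, so an edge counts at most twice there; an edge that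
    joins two of them crosses at least two of [X], [Y], [Z]. *)
Lemma deg3 s X Y Z :
  deg s (X :&: Y :&: Z) + deg s (X :\: (Y :|: Z)) + deg s (Y :\: (X :|: Z))
    + deg s (Z :\: (X :|: Y)) <= deg s X + deg s Y + deg s Z.
Proof.
rewrite /deg; elim: s => //= p s; rewrite /crosses !inE.
by do 6!case: (_ \in _) => /=; lia.
Qed.

Definition between z X p :=
  ((p.1 == z) && (p.2 \in X)) || ((p.2 == z) && (p.1 \in X)).

Lemma between_swap z X p : between z X (swap p) = between z X p.
Proof. by rewrite /between orbC. Qed.

Lemma degU1 s z X : z \notin X ->
  deg s X + deg s [set z] = deg s (z |: X) + 2 * count (between z X) s.
Proof.
move=> zX; rewrite /deg; elim: s => //= p s; rewrite /crosses /between !inE.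
have [->|_] := eqVneq p.1 z; have [->|_] := eqVneq p.2 z; rewrite ?(negPf zX) /=.
- by lia.
- by case: (_ \in _) => /=; lia.
- by case: (_ \in _) => /=; lia.
by do 2!case: (_ \in _) => /=; lia.
Qed.

(* [U] separates two vertices of [V]; [U] need not be contained in [V]. *)
Definition sep V U := ~~ [disjoint V & U] && ~~ (V \subset U).

Lemma sepP V U :
  reflect (exists x y, [/\ x \in V, x \in U, y \in V & y \notin U]) (sep V U).
Proof.
apply: (iffP andP) => [[/pred0Pn[x /andP[xV xU]] /subsetPn[y yV yU]]|].
  by exists x, y.
move=> [x [y [xV xU yV yU]]]; split.
  by apply/pred0Pn; exists x; apply/andP.
by apply/subsetPn; exists y.
Qed.

Lemma sepC V U : sep V U -> sep V (~: U).
Proof.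
by case/sepP => x [y [xV xU yV yU]]; apply/sepP; exists y, x; rewrite !inE negbK.
Qed.

Lemma sep_subset V W U : V \subset W -> sep V U -> sep W U.
Proof.
move/subsetP => VW /sepP[x [y [xV xU yV yU]]]; apply/sepP; exists x, y.
by split=> //; apply: VW.
Qed.

(** Loops outside [V] are tolerated. Keeping the type [T] fixed and shrinking [V] lets the induction
    remove a vertex without changing types. *)
Definition supported V s := forall v, v \notin V -> deg s [set v] = 0.

Lemma supported_ueq V s t : ueq s t -> supported V s -> supported V t.
Proof. by move=> st sV v /sV <-; rewrite (deg_ueq _ st). Qed.

Lemma supported_mem V s p :
  supported V s -> p \in s -> p.1 != p.2 -> (p.1 \in V) && (p.2 \in V).
Proof.
move=> sV ps np; rewrite -[_ && _]negbK negb_and; apply/negP.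
have cr v : crosses [set v] p -> v \notin V -> False.
  move=> crv /sV /eqP; apply/negP; rewrite -lt0n -has_count.
  by apply/hasP; exists p.
case/orP; apply: cr; rewrite /crosses !inE eqxx ?[p.2 == _]eq_sym (negPf np) //.
Qed.

Lemma leaves_setI V s p U : supported V s -> p \in s ->
  leaves (U :&: V) p = leaves U p.
Proof.
move=> sV ps; rewrite /leaves !inE; have [->|np] := eqVneq p.1 p.2.
  by rewrite !andbN.
by have /andP[-> ->] := supported_mem sV ps np; rewrite !andbT.
Qed.

Lemma out_setI V s U : supported V s -> out s (U :&: V) = out s U.
Proof. by move=> sV; apply: eq_in_count => p; apply: leaves_setI. Qed.

Lemma deg_setI V s U : supported V s -> deg s (U :&: V) = deg s U.
Proof.
move=> sV; apply: eq_in_count => p ps; rewrite /crosses !inE.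
have [->|np] := eqVneq p.1 p.2; first by rewrite !addbb.
by have /andP[-> ->] := supported_mem sV ps np; rewrite !andbT.
Qed.

Lemma incident_edge s z : 0 < deg s [set z] ->
  exists x s', x != z /\ ueq s ((z, x) :: s').
Proof.
rewrite -has_count => /hasP[[u v] ps]; rewrite /crosses !inE /=.
have [uz|uz] := eqVneq u z; have [vz|vz] //= := eqVneq v z; move=> _.
  by exists v, (rem (u, v) s); split=> //; rewrite -uz; apply: ueq_rem.
exists u, (rem (u, v) s); split=> //.
by apply: ueq_trans (ueq_rem ps) _; rewrite -vz; apply: ueq_swap.
Qed.

Lemma sub_in_count (P Q : pred (T * T)) s :
  {in s, forall p, P p -> Q p} -> count P s <= count Q s.
Proof.
move=> PQ; have -> : count P s = count (predI P Q) s; last first.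
  by apply: sub_count => p /andP[].
by apply: eq_in_count => p /PQ /=; case: (P p) => // ->.
Qed.

(* Lovász: if no pair containing [zx] can be split off, the dangerous sets
   through [x] cover the neighbours of [z]. As [z] has even degree, none of them
   meets more than half of its edges, so a minimal cover has at least three
   members, which contradicts [deg3]. *)
Lemma splitting_off m W z s : 1 < m -> z \notin W -> supported (z |: W) s ->
  (forall U, sep W U -> m <= deg s U) ->
  ~~ odd (deg s [set z]) -> 0 < deg s [set z] ->
  exists x y s', [/\ x != z, y != z, ueq s ((z, x) :: (z, y) :: s')
    & forall U, sep W U -> m <= deg ((x, y) :: s') U].
Proof.
move=> m_gt1 zW sW conn ev pos; have [x [s1 [xz ss1]]] := incident_edge pos.
have ds U : deg s U = crosses U (z, x) + deg s1 U by rewrite (deg_ueq _ ss1).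
pose N := [set y | (y != z) && (((z, y) \in s1) || ((y, z) \in s1))].
(* For sets avoiding [z], splitting off [zx] and [zy] lowers by two the degree of those containing
   both [x] and [y] and changes no other degree; the bound [m.+1] singles out the degrees that would
   fall below [m]. *)
pose dangerous X := [&& z \notin X, x \in X, sep W X & deg s X <= m.+1].
have inW y : ((z, y) \in (z, x) :: s1) || ((y, z) \in (z, x) :: s1) ->
    y != z -> y \in W.
  move=> ys yz; have sW1 := supported_ueq ss1 sW.
  by case/orP: ys => /(supported_mem sW1); rewrite /= ?[z == y]eq_sym yz;
    move=> /(_ isT)/andP[]; rewrite !inE !(negPf yz) /=.
have xW : x \in W by apply: inW => //; rewrite inE eqxx.
have NW y : y \in N -> y \in W.
  rewrite inE => /andP[yz ys]; apply: inW => //.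
  by rewrite !inE; case/orP: ys => ->; rewrite ?orbT.
have [/exists_inP[y]|] :=
    boolP [exists y in N, ~~ [exists X, dangerous X && (y \in X)]].
  rewrite inE => /andP[yz ys] /existsPn safe.
  have [s2 s1s2] : exists s2, ueq s1 ((z, y) :: s2).
    case/orP: ys => ys; first by exists (rem (z, y) s1); apply: ueq_rem.
    exists (rem (y, z) s1); apply: ueq_trans (ueq_rem ys) _.
    exact: ueq_swap (y, z) _.
  exists x, y, s2; split=> //.
    by apply: ueq_trans ss1 _; apply: ueq_cons.
  have ds2 U : deg s U = crosses U (z, x) + (crosses U (z, y) + deg s2 U).
    by rewrite ds (deg_ueq _ s1s2).
  have aux U : z \notin U -> sep W U -> m <= deg ((x, y) :: s2) U.
    move=> zU sU; have := conn _ sU; have := safe U.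
    rewrite /dangerous zU sU ds2 /= /crosses /= (negPf zU) /=.
    by case: (x \in U); case: (y \in U) => /=; clear; lia.
  move=> U sU; have [zU|zU] := boolP (z \in U); last exact: aux.
  by rewrite -degC; apply: aux; [rewrite inE zU | apply: sepC].
rewrite negb_exists_in => /forall_inP cov.
have cov1 y : y \in N -> exists2 X, dangerous X & y \in X.
  by move=> /cov; rewrite negbK => /existsP[X /andP[]]; exists X.
(* By [degU1] and [m <= deg s (z |: X)], the left side is at most [deg s [set z] + 1]; the even
   parity of [deg s [set z]] removes the extra one. *)
have half X : dangerous X -> 2 * count (between z X) s <= deg s [set z].
  case/and4P => zX xX sX dX; have := degU1 s zX.
  suff : m <= deg s (z |: X) by move: ev dX; clear; lia.
    apply: conn; case/sepP: sX => u [v [uW uX vW vX]]; apply/sepP; exists u, v.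
    by rewrite !inE uX orbT negb_or vX andbT; split=> //; apply: contraNneq zW => <-.
(* Otherwise [X] and [Y] together meet every non-loop edge at [z], and both meet [zx], so their
   counts add up to more than [deg s [set z]], against [half]. *)
have two X Y : dangerous X -> dangerous Y -> ~~ (N \subset X :|: Y).
  move=> dX dY; apply/negP => /subsetP NXY.
  have := half _ dX; have := half _ dY.
  rewrite !(ss1 _ (@between_swap z _)) ds /= /between /= eqxx.
  case/and4P: dX => zX -> _ _; case/and4P: dY => zY -> _ _.
  have -> : crosses [set z] (z, x) by rewrite /crosses !inE /= eqxx (negPf xz).
  suff : deg s1 [set z] <= count (between z X) s1 + count (between z Y) s1.
    by rewrite /between; lia.
  rewrite -count_predUI; apply: leq_trans (leq_addr _ _).
  apply: sub_in_count => -[u v] ps /=; rewrite /crosses /between !inE /=.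
  have [uz|uz] := eqVneq u z; have [vz|vz] //= := eqVneq v z; move=> _.
    have := NXY v; rewrite !inE vz -uz ps /= => /(_ isT).
    by case/orP => ->; rewrite ?orbT.
  have := NXY u; rewrite !inE uz -vz ps /= orbT => /(_ isT).
  by case/orP => ->; rewrite ?orbT.
pose covers (F : {set {set T}}) :=
  (F \subset [set X | dangerous X]) && (N \subset cover F).
have : exists F, covers F.
  exists [set X | dangerous X]; rewrite /covers subxx; apply/subsetP => y /cov1[X dX yX].
  by apply/bigcupP; exists X; rewrite ?inE.
move=> [F0 cF0]; have [F /minsetP[/andP[/subsetP dF /subsetP NF] minF] _] := minset_exists cF0.
have dng X : X \in F -> dangerous X by move/dF; rewrite inE.
(* By minimality of the cover, each member contains a neighbour that no other member covers. *)
have private X : X \in F ->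
    exists y, [/\ y \in N, y \in X & forall Y, Y \in F -> Y != X -> y \notin Y].
  move=> XF.
  have : ~~ (N \subset cover (F :\ X)).
    apply/negP => NFX; have : F :\ X = F.
      apply: minF; last exact: subsetDl.
      rewrite /covers NFX andbT; apply/subsetP => Y; rewrite in_setD1.
      by case/andP => _ /dF.
    by move/setP/(_ X); rewrite !inE eqxx XF.
  case/subsetPn => y yN yF; exists y.
  have nY Y : Y \in F -> Y != X -> y \notin Y.
    move=> YF YX; apply: contra yF => yY; apply/bigcupP; exists Y => //.
    by rewrite !inE YX.
  split=> //; have /bigcupP[Y YF yY] := NF _ yN.
  have [<-//|YX] := eqVneq Y X.
  by have := nY Y YF YX; rewrite yY.
have next X Y : X \in F -> Y \in F -> exists2 Z, Z \in F & (Z != X) && (Z != Y).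
  move=> XF YF; have /subsetPn[y yN] := two _ _ (dng _ XF) (dng _ YF).
  rewrite !inE negb_or => /andP[yX yY]; have /bigcupP[Z ZF yZ] := NF _ yN.
  exists Z => //; apply/andP.
  by split; [apply: contraNneq yX | apply: contraNneq yY] => <-.
(* The degree of [z] is even and positive, so some edge besides [zx] joins [z] to another vertex,
   and [N] is not empty. *)
have [X1 X1F] : exists X, X \in F.
  have : 0 < deg s1 [set z].
    move: ev pos; rewrite ds /crosses !inE /= eqxx (negPf xz) /=.
    by case: (deg s1 _).
  case/incident_edge => y [s2 [yz /ueq_sym/ueq_mem ys]].
  have /NF/bigcupP[X XF _] : y \in N by rewrite inE yz; apply: ys.
  by exists X.
have [X2 X2F /andP[n21 _]] := next _ _ X1F X1F.
have [X3 X3F /andP[n31 n32]] := next _ _ X1F X2F.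
have ge4 X Y Z : X \in F -> Y \in F -> Z \in F -> Y != X -> Z != X ->
    m <= deg s (X :\: (Y :|: Z)).
  move=> XF YF ZF YX ZX; apply: conn; apply/sepP.
  have [y [yN yX yn]] := private _ XF; exists y, x.
  rewrite !inE (negPf (yn _ YF YX)) (negPf (yn _ ZF ZX)) yX NW //.
  by have /and4P[_ -> _ _] := dng _ YF.
have geI : m <= deg s (X1 :&: X2 :&: X3).
  apply: conn; have /and4P[_ xX1 /sepP[_ [v [_ _ vW vX]]] _] := dng _ X1F.
  apply/sepP; exists x, v; rewrite !inE xX1 (negPf vX).
  by have /and4P[_ -> _ _] := dng _ X2F; have /and4P[_ -> _ _] := dng _ X3F.
have ge1 := ge4 _ _ _ X1F X2F X3F n21 n31.
have ge2 := ge4 _ _ _ X2F X1F X3F; rewrite eq_sym in ge2.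
have {}ge2 := ge2 n21 n32.
have ge3 := ge4 _ _ _ X3F X1F X2F; rewrite ![_ == X3]eq_sym in ge3.
have {}ge3 := ge3 n31 n32.
have /and4P[z1 x1 _ d1] := dng _ X1F; have /and4P[z2 x2 _ d2] := dng _ X2F.
have /and4P[z3 x3 _ d3] := dng _ X3F.
(* Without the edge [zx], each of the three sets has degree at most [m], their intersection at least
   [m - 1] and each of the three differences at least [m]. Then [4m - 1 <= 3m], against [1 < m]. *)
move: (deg3 s1 X1 X2 X3) ge1 ge2 ge3 geI d1 d2 d3.
rewrite !ds /crosses !inE /= (negPf z1) (negPf z2) (negPf z3) x1 x2 x3 /=.
by move: m_gt1; clear; lia.
Qed.

(* Uncrossing a minimal tight set. *)
Lemma tight_vertex m V s : 0 < m -> 1 < #|V| -> supported V s ->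
  (forall U, sep V U -> m <= deg s U) ->
  (forall p, p \in s -> exists2 U, sep V U & crosses U p && (deg s U <= m)) ->
  exists2 z, z \in V & deg s [set z] = m.
Proof.
move=> m_gt0 /card_gt1P[x0 [y0 [x0V y0V xy0]]] sV conn tight.
have sx0 : sep V [set x0].
  by apply/sepP; exists x0, y0; rewrite !inE eqxx eq_sym.
have : 0 < deg s [set x0] by apply: leq_trans (conn _ sx0).
rewrite -has_count => /hasP[p0 /tight[U0 sU0 /andP[_ dU0]] _].
pose good U := sep V U && (deg s U <= m).
have gU0 : good U0 by apply/andP.
case: (@arg_minnP _ U0 good (fun U => #|U|) gU0) => U /andP[sU dU] minU.
case/sepP: (sU) => x [v [xV xU vV vU]].
have smaller X : X \subset U -> sep V X -> deg s X <= m -> X = U.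
  move=> XU sX dX; apply/eqP; rewrite eqEcard XU; apply: minU.
  by apply/andP.
have [/hasP[p ps]|noin] := boolP (has (between x (U :\ x)) s).
  (* A tight set that separates two adjacent vertices of [U] would yield a smaller tight set: the
     intersection if the union leaves out a vertex of [V], and a difference otherwise. *)
  have key y : y \in U -> y != x -> y \in V -> forall U', sep V U' -> x \in U' ->
      y \notin U' -> deg s U' <= m -> False.
    move=> yU yx yV U' sU' xU' yU' dU'.
    have [/subsetP VUU|/subsetPn[w wV wUU]] := boolP (V \subset U :|: U'); last first.
      have sI : sep V (U :&: U').
        by apply/sepP; exists x, y; rewrite !inE xU xU' (negPf yU') andbF.
      have /conn dUU : sep V (U :|: U').
        by apply/sepP; exists x, w; rewrite !inE xU; split=> //; rewrite inE in wUU.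
      have : U :&: U' = U.
        apply: smaller => //; first exact: subsetIl.
        by move: (degI_degU s U U') dUU dU dU'; clear; lia.
      by move/setP/(_ y); rewrite !inE yU (negPf yU').
    have sD : sep V (U :\: U').
      by apply/sepP; exists y, x; rewrite !inE xU xU' (negPf yU') yU.
    have /conn dD : sep V (U' :\: U).
      apply/sepP; exists v, x; rewrite !inE xU vU; split=> //=.
      by have := VUU _ vV; rewrite !inE (negPf vU).
    have : U :\: U' = U.
      apply: smaller => //; first exact: subsetDl.
      by move: (degD_degD s U U') dD dU dU'; clear; lia.
    by move/setP/(_ x); rewrite !inE xU xU'.
  case: p ps => a b ps bt.
  have [y [yU yx cr]] : exists y, [/\ y \in U, y != x &
      (forall X, crosses X (a, b) = (x \in X) (+) (y \in X))].
    move: bt; rewrite /between !inE /=.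
    case/orP => /and3P[/eqP -> nx inU]; first by exists b.
    by exists a; split=> // X; rewrite /crosses addbC.
  have yV : y \in V.
    apply: contraT => /sV/eqP; rewrite -leqn0 leqNgt -has_count => /negP[].
    by apply/hasP; exists (a, b) => //; rewrite cr !inE eqxx eq_sym (negPf yx).
  have [U' sU' /andP[]] := tight _ ps; rewrite cr.
  have [xU'|xU'] := boolP (x \in U') => /= yU' dU'; exfalso.
    exact: (key y yU yx yV U').
  apply: (key y yU yx yV (~: U')); rewrite ?inE ?negbK ?degC //.
  exact: sepC.
(* With no edge from [x] to the rest of [U], the degrees of [[set x]] and [U :\ x] add up to at most
   [m]. They cannot both be at least [m], so [U :\ x] does not separate [V], and [U] meets [V] in
   [x] alone. *)
exists x => //; have := @degU1 s x (U :\ x); rewrite !inE eqxx setD1K // => /(_ isT).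
have [sUx|nsUx] := boolP (sep V (U :\ x)).
  have sx : sep V [set x].
    by apply/sepP; exists x, v; rewrite !inE eqxx; split=> //; apply: contraNneq vU => ->.
  by move: (conn _ sUx) (conn _ sx) noin dU m_gt0; rewrite has_count; clear; lia.
suff -> : [set x] = U :&: V.
  by rewrite deg_setI // => _; apply/eqP; rewrite eqn_leq dU conn.
apply/setP => w; rewrite !inE; have [->|wx] := eqVneq w x; first by rewrite xU.
apply/esym/negbTE; apply: contra nsUx => /andP[wU wV]; apply/sepP.
by exists w, x; rewrite !inE eqxx wx.
Qed.

Lemma out_split a x y z U :
  out ((x, y) :: a) U <= out ((x, z) :: (z, y) :: a) U.
Proof. rewrite /out /= /leaves /=.
by case: (x \in U); case: (y \in U); case: (z \in U) => /=; lia. Qed.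

(* Reroutes through [z] the arc that replaced the two edges split off at [z]. *)
Lemma unsplit z x y s a : x != z -> y != z -> ueq ((x, y) :: s) a ->
  out a [set z] = out a (~: [set z]) ->
  exists b, [/\ ueq ((z, x) :: (z, y) :: s) b, forall U, out a U <= out b U
              & out b [set z] = out b (~: [set z])].
Proof.
(* The orientation [a] may direct the new edge either way; the situation is symmetric in [x] and
   [y]. *)
wlog xya : x y / (x, y) \in a => [th|] xz yz sa bal.
  have /orP[xya|yxa] := ueq_mem sa; first exact: th.
  have [|b [sb ub bb]] := th y x yxa yz xz _ bal.
    by apply: ueq_trans sa; apply: ueq_swap (y, x) _.
  exists b; split=> //; apply: ueq_trans sb => P _ /=; lia.
have pa := permP (perm_to_rem xya).
have oa U : out a U = leaves U (x, y) + out (rem (x, y) a) U by apply: pa.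
exists ((x, z) :: (z, y) :: rem (x, y) a); split=> [P Ps|U|].
- have := sa P Ps; rewrite pa /=.
  have := Ps (z, x); rewrite /swap /= => ->; lia.
- by rewrite oa; apply: out_split.
move: bal; rewrite !oa /out /= /leaves !inE /= eqxx (negPf xz) (negPf yz) /=.
by lia.
Qed.

(** Induction on [#|V|], then on the number of edges. An edge whose deletion keeps the cut condition
    is deleted and put back in any direction. If there is none, some vertex [z] has degree [2 * k];
    its edges are split off in pairs, the rest is oriented by induction on [V :\ z], and the
    splittings are undone. *)
Theorem nash_williams k V s : supported V s ->
  (forall U, sep V U -> 2 * k <= deg s U) ->
  exists2 a, ueq s a & forall U, sep V U -> k <= out a U.
Proof.
case: (posnP k) => [->|k_gt0]; first by exists s.
have [n] := ubnP #|V|; elim: n V s => // n IHV V s ltVn.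
(* Only cuts that separate [V :\ z] are controlled here, since splitting off at [z] preserves no
   others; the balance at [z] takes care of the remaining ones. *)
have eulerian z s' : z \in V -> supported V s' ->
    (forall U, sep (V :\ z) U -> 2 * k <= deg s' U) -> ~~ odd (deg s' [set z]) ->
    exists a, [/\ ueq s' a, forall U, sep (V :\ z) U -> k <= out a U
                & out a [set z] = out a (~: [set z])].
  move=> zV; have [d] := ubnP (deg s' [set z]).
  elim: d s' => // d IHd s' ltd sV conn ev.
  have [d0|dpos] := posnP (deg s' [set z]).
    have [||//|a sa aV] := IHV (V :\ z) s'.
    - by move: ltVn; rewrite (cardsD1 z V) zV; lia.
    - move=> v; rewrite !inE negb_and negbK => /orP[/eqP -> //|]; exact: sV.
    exists a; split=> //.
    by move: d0; rewrite (deg_ueq _ sa) deg_out; lia.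
  have [|||x [y [s1 [xz yz ss1 conn1]]]] := @splitting_off (2 * k) (V :\ z) z s' _ _ _ conn ev dpos.
  - lia.
  - by rewrite !inE eqxx.
  - by rewrite setD1K.
  have ds U : deg s' U = crosses U (z, x) + (crosses U (z, y) + deg s1 U).
    by rewrite (deg_ueq _ ss1).
  have dz : deg s' [set z] = (deg ((x, y) :: s1) [set z]).+2.
    by rewrite ds /= /crosses !inE /= eqxx (negPf xz) (negPf yz).
  have [||//||a [sa aV abal]] := IHd ((x, y) :: s1).
  - by move: ltd; rewrite dz; lia.
  - move=> v vV; have vz : z != v by apply: contraNneq vV => <-.
    have := sV v vV; rewrite ds /= /crosses !inE /= (negPf vz) /=.
    by case: (x == v); case: (y == v) => /=; lia.
  - by move: ev; rewrite dz /= negbK.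
  have [b [sb ab bbal]] := unsplit xz yz sa abal.
  exists b; split=> //; first exact: ueq_trans ss1 sb.
  by move=> U /aV kU; apply: leq_trans kU (ab U).
have [l] := ubnP (size s); elim: l s => // l IHl s ltl sV conn.
have [V1|V1] := leqP #|V| 1.
  exists s => // U /sepP[x [y [xV xU yV yU]]].
  have := card_le1_eqP V1 _ _ xV yV => xy.
  by rewrite xy xU in yU.
have [/hasP[p ps /forallP del]|nodel] := boolP
   (has (fun p => [forall U, sep V U ==> (2 * k <= deg (rem p s) U)]) s).
  have spr := ueq_rem ps.
  have [|||a sa aV] := IHl (rem p s).
  - by rewrite size_rem //; case: (s) ps ltl => //= *; lia.
  - by move=> v /sV; rewrite (deg_ueq _ spr) /=; lia.
  - by move=> U; apply/implyP.
  exists (p :: a); first exact: ueq_trans spr (ueq_cons _ sa).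
  by move=> U /aV; rewrite /out /=; lia.
have [||z zV dz] := @tight_vertex (2 * k) V s _ V1 sV conn.
- lia.
- move=> p ps; have /hasPn/(_ p ps) := nodel.
  rewrite negb_forall => /existsP[U]; rewrite negb_imply => /andP[sU].
  rewrite -ltnNge => lt; exists U => //.
  have := conn _ sU; rewrite !(deg_ueq _ (ueq_rem ps)) /=.
  by case: (crosses U p) => /=; lia.
have [||a [sa aV abal]] := eulerian z s zV sV.
- by move=> U sU; apply: conn; apply: sep_subset sU; apply: subsetDl.
- by rewrite dz; lia.
exists a => // U sU.
have ka : k <= out a [set z].
  by move: dz; rewrite (deg_ueq _ sa) deg_out -abal; lia.
have sVa := supported_ueq sa sV.
(* A set that separates [V] but not [V :\ z] meets [V] in [z] alone or in everything but [z]. Since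
   [z] has degree [2 * k] and is balanced, [k] arcs leave either one. *)
have [/aV //|nsep] := boolP (sep (V :\ z) U).
case/sepP: sU => x [y [xV xU yV yU]].
have [zU|zU] := boolP (z \in U).
  have yz : y != z by apply: contraNneq yU => ->.
  rewrite -(out_setI U sVa) [U :&: V](_ : _ = [set z]) //.
  apply/setP => w; rewrite !inE; have [->|wz] := eqVneq w z; first by rewrite zU.
  apply/negbTE; apply: contra nsep => /andP[wU wV]; apply/sepP.
  by exists w, y; rewrite !inE wz yz.
have xz : x != z by apply: contraNneq zU => <-.
rewrite -(out_setI U sVa) [U :&: V](_ : _ = ~: [set z] :&: V).
  by rewrite out_setI // -abal.
apply/setP => w; rewrite !inE; have [->|wz] /= := eqVneq w z.
  by rewrite (negPf zU).
apply/idP/idP => [/andP[]//|wV]; rewrite wV andbT; apply: contraNT nsep => wU; apply/sepP.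
by exists x, w; rewrite !inE wz xz.
Qed.

End Multigraphs.

(** * Menger's theorem *)

Section Menger.

Variable T : finType.
Implicit Types (s F Q R : seq (T * T)) (U : {set T}) (u v : T) (p : seq T).

Definition tails s U := count (fun q => q.1 \in U) s.
Definition heads s U := count (fun q => q.2 \in U) s.

(** Conservation for a flow of value [j] from [u] to [v] with one unit on each entry of [s], summed
    over vertex sets and written without subtraction. *)
Definition flow u v j s :=
  forall U, tails s U + j * (v \in U) = heads s U + j * (u \in U).

Definition spath s u v p :=
  [&& path [rel x y | (x, y) \in s] u p, last u p == v & uniq (u :: p)].

Lemma arcs_flow u p : flow u (last u p) 1 (arcs u p).
Proof.
rewrite /flow => U; rewrite /tails /heads.
elim: p u => //= x p IH u; have := IH x; rewrite /arcs.
by case: p {IH} => //= *; lia.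
Qed.

Lemma uniq_arcs u p : uniq (u :: p) -> uniq (arcs u p).
Proof.
case/andP => _ up; apply: (@map_uniq _ _ snd).
by rewrite -/(unzip2 _) unzip2_zip.
Qed.

Lemma arcs_subset s u p :
  path [rel x y | (x, y) \in s] u p -> {subset arcs u p <= s}.
Proof.
elim: p u => //= x p IH u /andP[uxs /IH ps] q.
rewrite /arcs /= inE => /orP[/eqP -> //|].
exact: ps.
Qed.

Lemma perm_uniq_subset Q s : uniq Q -> {subset Q <= s} ->
  exists R, perm_eq s (Q ++ R).
Proof.
move=> uQ Qs; have /count_subseqP[s1 s1s Qs1] :
    forall q, count_mem q Q <= count_mem q s.
  move=> q; rewrite count_uniq_mem //; case: (boolP (q \in Q)) => // /Qs.
  by rewrite -has_pred1 has_count.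
have [R sR] := perm_to_subseq s1s; exists R; apply: perm_trans sR _.
by rewrite perm_cat2r perm_sym.
Qed.

(** If [v] were not reachable, no arc would leave the set of vertices reachable from [u]. *)
Lemma spath_exists s u v :
  (forall U, u \in U -> v \notin U -> 0 < out s U) -> exists p, spath s u v p.
Proof.
move=> cut; have [/connectP[p ps ->]|nuv] :=
    boolP (connect [rel x y | (x, y) \in s] u v).
  by case/shortenP: ps => p' p's up' _; exists p'; rewrite /spath p's eqxx up'.
have := cut [set x | connect [rel x y | (x, y) \in s] u x].
rewrite !inE connect0 => /(_ isT nuv); rewrite -has_count => /hasP[[x y] xys].
rewrite /leaves !inE /= => /andP[ux /negP[]].
by apply: connect_trans ux _; apply: connect1.
Qed.

(* Pushes one unit along the residual walk [Q]: arcs of [Q] taken from [R] enter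
   the flow, those that reverse an arc of [F] cancel it. *)
Lemma push_flow Q F R S : perm_eq (map (@swap T) F ++ R) (Q ++ S) ->
  exists F' R', perm_eq (F' ++ R') (F ++ R) /\
    forall U, tails F' U + heads F U + heads Q U
            = heads F' U + tails F U + tails Q U.
Proof.
elim: Q F R S => [|q Q IH] F R S.
  by exists F, R; split=> // U; rewrite /tails /heads /=; lia.
move=> pq; have : q \in map (@swap T) F ++ R.
  by rewrite (perm_mem pq) inE eqxx.
move/permP in pq; rewrite mem_cat => /orP[/mapP[q' q'F qq']|qR].
  have pF := permP (perm_to_rem q'F).
  have pF' := permP (perm_map (@swap T) (perm_to_rem q'F)).
  (* Cancelling [q'] frees it, so in the residual list [q'] replaces its reverse [q]; the rest of
     the walk is still available. *)
  have [|F' [R' [FR eqU]]] := IH (rem q' F) (q' :: R) (q' :: S).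
    apply/permP => P; have := pq P; have := pF' P.
    by rewrite /= !count_cat /= -qq' => -> ; clear; lia.
  exists F', R'; split.
    apply/permP => P; rewrite (permP FR P) !count_cat pF /=; clear; lia.
  move=> U; have := eqU U; rewrite /tails /heads !pF qq' /=; clear; lia.
have pR := permP (perm_to_rem qR).
have [|F' [R' [FR eqU]]] := IH (q :: F) (rem q R) (swap q :: S).
  apply/permP => P; have := pq P; have := pR P.
  by rewrite /= !count_cat /= => -> ; clear; lia.
exists F', R'; split.
  apply/permP => P; rewrite (permP FR P) !count_cat pR /=; clear; lia.
by move=> U; have := eqU U; rewrite /tails /heads /=; clear; lia.
Qed.

Lemma tails_out s U : tails s U + out s (~: U) = heads s U + out s U.
Proof.
rewrite /tails /heads /out; elim: s => //= q s; rewrite /leaves !inE.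
by case: (_ \in U); case: (_ \in U) => /=; lia.
Qed.

Lemma out_swap s U : out (map (@swap T) s) U = out s (~: U).
Proof.
rewrite /out count_map; apply: eq_count => q; rewrite /leaves /= !inE negbK.
by rewrite andbC.
Qed.

(** Across a cut with at least [k.+1] arcs, a flow of value [k] leaves a residual arc, so there is a
    residual path from [u] to [v] along which one more unit can be pushed. *)
Lemma max_flow_min_cut u v k s :
  (forall U, u \in U -> v \notin U -> k <= out s U) ->
  exists F R, perm_eq (F ++ R) s /\ flow u v k F.
Proof.
elim: k => [|k IH] cut; first by exists [::], s; split=> // U; rewrite /= !mul0n.
have [|F [R [FR fF]]] := IH; first by move=> U uU vU; apply/ltnW/cut.
have [|p /and3P[pp /eqP pv up]] := @spath_exists (map (@swap T) F ++ R) u v.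
  move=> U uU vU; have := cut U uU vU; have := fF U; have := tails_out F U.
  have -> : out s U = out F U + out R U by rewrite /out -(permP FR) count_cat.
  rewrite /out count_cat -!/(out _ _) out_swap uU (negPf vU); clear; lia.
have [S pS] := perm_uniq_subset (uniq_arcs up) (arcs_subset pp).
have [F' [R' [F'R' eqU]]] := push_flow pS.
exists F', R'; split; first exact: perm_trans F'R' FR.
move=> U; have := eqU U; have := fF U; have := arcs_flow u p U; rewrite pv.
by case: (u \in U); case: (v \in U) => /=; clear; lia.
Qed.

(** Taking away the arcs of one path lowers the value of the flow by one. As [F] has no repetition,
    later paths avoid those arcs; what remains at the end is a circulation and is dropped. *)
Lemma flow_paths u v k F : u != v -> uniq F -> flow u v k F ->
  exists Ps : seq (seq T), [/\ size Ps = k, all (spath F u v) Ps &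
    pairwise (fun p q => [disjoint arcs u p & arcs u q]) Ps].
Proof.
move=> uv; elim: k F => [|k IH] F uF fF; first by exists [::].
have [|p spF] := @spath_exists F u v.
  move=> U uU vU; have := fF U; have := tails_out F U.
  by rewrite uU (negPf vU); clear; lia.
have /and3P[pp /eqP pv up] := spF.
have [F' pF'] := perm_uniq_subset (uniq_arcs up) (arcs_subset pp).
have := uF; rewrite (perm_uniq pF') cat_uniq => /and3P[_ /hasPn dis uF'].
have [|Ps [sPs aPs dPs]] := IH F' uF'.
  move=> U; have := fF U; have := arcs_flow u p U; rewrite pv /tails /heads.
  rewrite !(permP pF') !count_cat.
  by case: (u \in U); case: (v \in U) => /=; clear; lia.
exists (p :: Ps); split; rewrite /= ?sPs ?spF ?dPs ?andbT //=.
  apply/allP => q /(allP aPs)/and3P[qp qv uq]; rewrite /spath qv uq !andbT.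
  apply: sub_path qp => x y /=; rewrite (perm_mem pF') mem_cat => ->.
  by rewrite orbT.
apply/allP => q /(allP aPs)/and3P[qp qv uq].
rewrite disjoint_sym disjoint_subset; apply/subsetP => a /(arcs_subset qp) aF'.
exact: (dis _ aF').
Qed.

Theorem menger (A : {set T * T}) k :
  (forall U, sep setT U -> k <= out (enum A) U) -> arc_strong k A.
Proof.
move=> cut; apply/forallP => u; apply/forallP => v; apply/implyP => uv.
have [|F [R [FR fF]]] := @max_flow_min_cut u v k (enum A).
  by move=> U uU vU; apply: cut; apply/sepP; exists u, v; rewrite !inE.
have FA : {subset F <= A}.
  by move=> a aF; rewrite -mem_enum -(perm_mem FR) mem_cat aF.
have uF : uniq F.
  by have := enum_uniq A; rewrite -(perm_uniq FR) cat_uniq => /andP[].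
have [Ps [sPs /allP aPs /(pairwiseP [::]) dPs]] := flow_paths uv uF fF.
have sP i : i < k -> spath F u v (nth [::] Ps i).
  by move=> ik; apply: aPs; rewrite mem_nth ?sPs.
have szP (i : 'I_k) : size (nth [::] Ps i) <= #|T|.
  have /and3P[_ _ /andP[_ un]] := sP i (ltn_ord i).
  by rewrite -(card_uniqP un) max_card.
apply/existsP; exists [ffun i => Bseq (szP i)]; apply/andP; split.
  apply/forallP => i; rewrite ffunE /=; have /and3P[pp lp up] := sP i (ltn_ord i).
  apply/and3P; split=> //; apply: sub_path pp => x y; exact: FA.
apply/forallP => i; apply/forallP => j; apply/implyP => ij; rewrite !ffunE /=.
have [lt_ij|lt_ji|/ord_inj eq_ij] := ltngtP i j.
- by apply: dPs; rewrite ?inE ?sPs.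
- by rewrite disjoint_sym; apply: dPs; rewrite ?inE ?sPs.
by rewrite eq_ij eqxx in ij.
Qed.

End Menger.

(** * Orientations and subgraphs *)

Section Orientations.

Variables (T : finType) (e : rel T).
Hypotheses (e_sym : symmetric e) (e_irr : irreflexive e).
Implicit Types (q r : T * T) (x y : T) (U : {set T}) (Z X A : {set T * T}).
Implicit Type Y : {set {set T}}.

Definition edge q : {set T} := [set q.1; q.2].

Lemma edge_swap q : edge (swap q) = edge q.
Proof. by rewrite /edge setUC. Qed.

Lemma edge_eq q r : edge q = edge r -> q = r \/ q = swap r.
Proof.
case: q r => [a b] [c d]; rewrite /edge /= => eqe.
have /set2P ha : a \in [set c; d] by rewrite -eqe set21.
have /set2P hb : b \in [set c; d] by rewrite -eqe set22.
have /set2P hc : c \in [set a; b] by rewrite eqe set21.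
have /set2P hd : d \in [set a; b] by rewrite eqe set22.
by rewrite /swap /=; case: ha; case: hb; case: hc; case: hd => *; subst; auto.
Qed.

(* Reference orientation: orientations of [e] correspond to subsets of it. *)
Definition ref_arcs : {set T * T} :=
  [set q | e q.1 q.2 && (enum_rank q.1 < enum_rank q.2)].

(** For [Z] within [ref_arcs], this is the orientation that agrees with the reference exactly on
    [Z]. *)
Definition orient Z : {set T * T} :=
  Z :|: [set q | swap q \in ref_arcs :\: Z].

Lemma in_orient q Z :
  (q \in orient Z) = (q \in Z) || (swap q \in ref_arcs) && (swap q \notin Z).
Proof. by rewrite !inE [in RHS]andbC. Qed.

Lemma ref_arcs_swap q : q \in ref_arcs -> swap q \notin ref_arcs.
Proof. by rewrite !inE => /andP[_ lt]; rewrite negb_and -leqNgt (ltnW lt) orbT. Qed.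

Lemma ref_arcs_total x y :
  e x y -> ((x, y) \in ref_arcs) (+) ((y, x) \in ref_arcs).
Proof.
move=> exy; rewrite !inE /= -[e y x]e_sym exy /=.
have : x != y by apply: contraTneq exy => ->; rewrite e_irr.
rewrite -(inj_eq enum_rank_inj) -(inj_eq val_inj) /=.
by case: ltngtP.
Qed.

Lemma ref_arcsN x y : e x y = false -> ((x, y) \in ref_arcs) = false.
Proof. by rewrite inE /= => ->. Qed.

Lemma edge_inj : {in ref_arcs &, injective edge}.
Proof.
move=> q r qA rA /edge_eq[// | eqr]; move: qA.
by rewrite eqr (negPf (ref_arcs_swap rA)).
Qed.

Lemma edgesP f : reflect (exists2 q, q \in ref_arcs & f = edge q) (f \in edges e).
Proof.
apply: (iffP imsetP) => [[[x y]]|[q]]; rewrite inE /=; last first.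
  by case/andP => eq _ ->; exists q; rewrite ?inE.
move=> exy ->; have := ref_arcs_total exy.
have [xyA _|_ /= yxA] := boolP ((x, y) \in ref_arcs); first by exists (x, y).
by exists (y, x) => //; rewrite -edge_swap.
Qed.

Lemma orientK Z : Z \subset ref_arcs -> orient Z :&: ref_arcs = Z.
Proof.
move/subsetP => ZA; apply/setP => q; rewrite in_setI in_orient.
have [qZ|qZ] /= := boolP (q \in Z); first exact: ZA.
by apply/negbTE/negP => /andP[/andP[/ref_arcs_swap + _] qA]; rewrite swapK qA.
Qed.

Lemma orientation_orient Z : Z \subset ref_arcs -> orientation e (orient Z).
Proof.
move/subsetP => ZA; apply/forallP => x; apply/forallP => y.
have nZ q : q \notin ref_arcs -> (q \in Z) = false.
  by move=> qA; apply/negbTE; apply: contra qA; apply: ZA.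
rewrite !in_orient /swap /=; case: ifP => [exy|nexy].
  have := ref_arcs_total exy.
  have [xyA|xyA] /= := boolP ((x, y) \in ref_arcs) => yxA.
    by rewrite (negPf yxA) (nZ _ yxA) /= orbF; case: (_ \in Z).
  by rewrite yxA (nZ _ xyA) /= orbF; case: (_ \in Z).
by rewrite nZ ?ref_arcsN // e_sym.
Qed.

Lemma orient_setI A : orientation e A -> orient (A :&: ref_arcs) = A.
Proof.
move=> /forallP oA; apply/setP => -[x y]; rewrite in_orient !in_setI /swap /=.
have /forallP/(_ y) := oA x; case: ifP => [exy|nexy].
  have := ref_arcs_total exy.
  by do 4!case: (_ \in _).
by move=> /negPf ->; rewrite [(y, x) \in _]ref_arcsN // e_sym.
Qed.

Definition strong_subsets k : {set {set T * T}} :=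
  [set Z in powerset ref_arcs | arc_strong k (orient Z)].

Lemma card_strong_subsets k :
  #|arc_strong_orientations e k| = #|strong_subsets k|.
Proof.
have -> : arc_strong_orientations e k = orient @: strong_subsets k.
  apply/setP => A; rewrite inE; apply/andP/imsetP => [[oA sA]|[Z + ->]].
    exists (A :&: ref_arcs); last by rewrite orient_setI.
    by rewrite inE powersetE subsetIr orient_setI.
  by rewrite inE powersetE => /andP[ZA sZ]; split=> //; apply: orientation_orient.
apply: card_in_imset => Y Z; rewrite !inE => /andP[YA _] /andP[ZA _] YZ.
by rewrite -(orientK YA) YZ orientK.
Qed.

(** The arcs of a walk form a unit flow, whose net value out of [U] is one. *)
Lemma arcs_leaves U x p : x \in U -> last x p \notin U -> has (leaves U) (arcs x p).
Proof.
move=> xU pU; have := arcs_flow x p U; have := tails_out (arcs x p) U.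
by rewrite has_count xU (negPf pU) -/(out _ _); clear; lia.
Qed.

Lemma shattered_edge_connected k X : shattered (strong_subsets k) X ->
  edge_connected k (edge @: (ref_arcs :\: X)).
Proof.
move=> /shatteredP sh; apply/forallP => F; apply/implyP => /andP[FY ltF].
apply/forallP => x; apply/forallP => y; apply: contraT => nxy.
set Y := edge @: _ in FY nxy.
pose U := [set w | connect (adj (Y :\: F)) x w].
have xU : x \in U by rewrite inE connect0.
have yU : y \notin U by rewrite inE.
(* This trace keeps an arc of [X] if its tail is in [U] and reverses it otherwise, so no edge of [X]
   is directed into [U]. An arc entering [U] then comes from [Y], and from [F] because [U] is a
   component of [Y :\: F]. *)
have [|Z] := sh [set q in X | q.1 \in U].
  by apply/subsetP => q; rewrite inE => /andP[].
rewrite inE powersetE => /andP[/subsetP ZA /forallP/(_ y)/forallP/(_ x)] + ZX.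
have -> : y != x by apply: contraNneq yU => ->.
case/existsP => P /andP[/forallP Ppath /forallP Pdis].
have ZXE q : q \in X -> (q \in Z) = (q.1 \in U).
  by move=> qX; have /setP/(_ q) := ZX; rewrite !inE qX andbT.
have enterF q : q \in orient Z -> leaves (~: U) q -> edge q \in F.
  rewrite /leaves !inE negbK => qZ /andP[q1 q2].
  have qY : edge q \in Y.
    case/orP: qZ => [qZ|/andP[sqZ sqA]].
      apply: imset_f; rewrite inE ZA // andbT; apply: contra q1 => qX.
      by have := ZXE q qX; rewrite qZ inE => <-.
    rewrite -edge_swap; apply: imset_f; rewrite inE [_ \in ref_arcs]inE sqA andbT.
    by apply: contra sqZ => sqX; rewrite ZXE // inE.
  apply: contraNT q1 => qF; apply: connect_trans q2 _; apply: connect1.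
  by rewrite /adj /= setUC -/(edge q) in_setD qF.
have [f fP] : exists f : 'I_k -> T * T, forall i,
    (f i \in arcs y (P i)) && leaves (~: U) (f i).
  apply: (@fin_all_exists _ (fun=> (T * T)%type)
    (fun i q => (q \in arcs y (P i)) && leaves (~: U) q)) => i.
  have /and3P[_ /eqP lastP _] := Ppath i.
  have [||q qP ql] := hasP (@arcs_leaves (~: U) y (P i) _ _).
  - by rewrite inE.
  - by rewrite inE negbK lastP.
  by exists q; rewrite qP.
(* Two arcs entering [U] cannot be opposite, so equal edges mean equal arcs, which disjointness of
   the paths excludes. Hence [F] has at least [k] edges. *)
have f_inj : injective (fun i => edge (f i)).
  move=> i j /edge_eq; have /andP[fi li] := fP i; have /andP[fj lj] := fP j.
  case=> [eqf|eqf]; last first.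
    by move: li lj; rewrite eqf /leaves /= !inE !negbK => /andP[_ ->].
  apply/eqP; apply: contraT => ij.
  have /forallP/(_ j) := Pdis i; rewrite ij /= => /pred0P/(_ (f i)) /=.
  by rewrite fi eqf fj.
have : #|[set edge (f i) | i : 'I_k]| <= #|F|.
  apply: subset_leq_card; apply/subsetP => _ /imsetP[i _ ->].
  have /andP[fi li] := fP i; apply: enterF => //.
  have /and3P[pp _ _] := Ppath i; rewrite -mem_enum; apply: arcs_subset fi.
  by apply: sub_path pp => a b /=; rewrite mem_enum.
by rewrite card_imset // card_ord leqNgt ltF.
Qed.

Definition arcs_of Y : {set T * T} :=
  [set q in ref_arcs | edge q \in Y].

Lemma arcs_ofK Y : Y \subset edges e -> edge @: arcs_of Y = Y.
Proof.
move/subsetP => YE; apply/setP => f; apply/imsetP/idP => [[q]|fY].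
  by rewrite inE => /andP[_ qY] ->.
have /edgesP[q qA fq] := YE _ fY.
by exists q; rewrite // inE qA -fq.
Qed.

(** Removing the edges across [U] makes [U] closed under adjacency and so disconnects the graph. *)
Lemma deg_arcs_of k Y U : Y \subset edges e -> edge_connected k Y ->
  sep setT U -> k <= deg (enum (arcs_of Y)) U.
Proof.
move=> YE /forallP conn /sepP[x [y [_ xU _ yU]]]; rewrite leqNgt; apply/negP => lt.
pose C := [set q in arcs_of Y | crosses U q].
have cC : #|C| = deg (enum (arcs_of Y)) U.
  rewrite /deg -size_filter -(card_uniqP (filter_uniq _ (enum_uniq _))).
  by apply: eq_card => q; rewrite inE mem_filter mem_enum andbC.
have /implyP := conn (edge @: C); rewrite (leq_ltn_trans (leq_imset_card _ _)) ?cC //.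
rewrite andbT; have -> : edge @: C \subset Y.
  by apply/subsetP => f /imsetP[q + ->]; rewrite !inE => /andP[/andP[]].
move=> /(_ isT)/forallP/(_ x)/forallP/(_ y).
have cl : closed (adj (Y :\: edge @: C)) (mem U).
  move=> a b; rewrite /adj /= in_setD -/(edge (a, b)) => /andP[nC abY].
  have /imsetP[q qY abq] : edge (a, b) \in edge @: arcs_of Y by rewrite arcs_ofK.
  have : ~~ crosses U q.
    apply: contra nC => cq; rewrite abq; apply: imset_f.
    by rewrite inE qY.
  have -> : crosses U q = crosses U (a, b).
    by case: (edge_eq abq) => ->; rewrite ?crosses_swap.
  by rewrite /crosses /=; case: (a \in U); case: (b \in U).
by move/(closed_connect cl); rewrite xU (negPf yU).
Qed.

(** [ref_arcs] never contains both an arc and its reverse, so at most one entry of [s] is [q] or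
    [swap q]. This test is symmetric, hence [ueq] carries the bound over to [a]. *)
Lemma orientation_uniq s a : uniq s -> {subset s <= ref_arcs} -> ueq s a ->
  uniq a /\ {in a, forall q, (q \in s) (+) ((swap q \in s) && (swap q \notin a))}.
Proof.
move=> us sA sa.
have le1 q : count (predU (pred1 q) (pred1 (swap q))) a <= 1.
  rewrite -(sa _); last first.
    by move=> r /=; rewrite (inj_eq (can_inj (@swapK T))) (can2_eq (@swapK T) (@swapK T)) orbC.
  have := count_predUI (pred1 q) (pred1 (swap q)) s.
  rewrite !count_uniq_mem //.
  have : ~~ ((q \in s) && (swap q \in s)).
    by apply/negP => /andP[/sA/ref_arcs_swap/negP qA /sA].
  by case: (q \in s); case: (_ \in s) => //= _; clear; lia.
have count_le q : count_mem q a <= 1.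
  by apply: leq_trans (le1 q); apply: sub_count => r /= ->.
split.
  apply: count_mem_uniq => q; have := count_le q.
  by rewrite -has_pred1 has_count; case: (count_mem q a) => [|[]].
move=> q qa; have : (q \in s) || (swap q \in s).
  by apply: ueq_mem; apply: ueq_trans (ueq_sym sa); apply/ueq_sym/ueq_rem.
have [qs _|qs /= sqs] := boolP (q \in s).
  by have /negPf := ref_arcs_swap (sA _ qs); case: (boolP (swap q \in s)) => // /sA ->.
rewrite sqs /=; apply/negP => sqa; have := le1 q.
have neq : q != swap q by apply: contraNneq qs => ->.
have := count_predUI (pred1 q) (pred1 (swap q)) a.
have -> : count (predI (pred1 q) (pred1 (swap q))) a = 0.
  by apply/eqP; rewrite -leqn0 leqNgt -has_count; apply/hasPn => r _ /=;
     apply/negP => /andP[/eqP ->]; apply/negP.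
move: qa sqa; rewrite -!has_pred1 !has_count; clear; lia.
Qed.

Lemma edge_connected_not_shattered k Y : Y \subset edges e ->
  edge_connected (2 * k) Y ->
  ~~ shattered (powerset ref_arcs :\: strong_subsets k) (arcs_of Y).
Proof.
move=> YE conn; apply/negP => /shatteredP sh.
have [||a sa ka] := @nash_williams T k setT (enum (arcs_of Y)).
- by move=> v; rewrite inE.
- by move=> U; apply: deg_arcs_of.
have [|ua aY] := orientation_uniq (enum_uniq _) _ sa.
  by move=> q; rewrite mem_enum inE => /andP[].
(* Any [Z] with this trace directs the edges of [Y] as [a] does, so [orient Z] contains [a] and
   inherits its cuts. *)
have [|Z] := sh [set q in arcs_of Y | q \in a].
  by apply/subsetP => q; rewrite inE => /andP[].
rewrite in_setD inE => /andP[+ ZA] ZY; rewrite ZA /= => /negP[].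
have ZE q : q \in arcs_of Y -> (q \in Z) = (q \in a).
  by move=> qY; have /setP/(_ q) := ZY; rewrite in_setI qY andbT => ->; rewrite in_set qY.
have aZ : {subset a <= enum (orient Z)}.
  move=> q qa; rewrite mem_enum in_orient; have := aY q qa; rewrite !mem_enum.
  have [qY _|_ /= /andP[sqY sqa]] := boolP (q \in arcs_of Y); first by rewrite ZE ?qa.
  by rewrite [swap q \in Z]ZE // sqa; move: sqY; rewrite inE => /andP[-> _]; rewrite orbT.
have [R oR] := perm_uniq_subset ua aZ.
apply: menger => U /ka kU; rewrite /out (permP oR) count_cat.
exact: leq_trans kU (leq_addr _ _).
Qed.

(** The sets shattered by [weak] and the sets [arcs_of Y], for [Y] a [2k]-edge-connected subgraph,
    are distinct subsets of [ref_arcs]. Together they number at most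
    [#|strong_subsets k| + #|weak|], and Pajor's inequality cancels [#|weak|]. *)
Lemma card_edge_connected_le k :
  #|edge_connected_subgraphs e (2 * k)| <= #|arc_strong_orientations e k|.
Proof.
rewrite card_strong_subsets.
pose weak := powerset ref_arcs :\: strong_subsets k.
have cweak : #|powerset ref_arcs| = #|strong_subsets k| + #|weak|.
  have sub : strong_subsets k \subset powerset ref_arcs.
    by apply/subsetP => Z; rewrite inE => /andP[].
  by rewrite -(cardsID (strong_subsets k) (powerset ref_arcs)) (setIidPr sub).
have shA X : shattered weak X -> X \subset ref_arcs.
  by apply: shattered_subset => Z; rewrite !inE => /andP[].
have inj : {in edge_connected_subgraphs e (2 * k) &, injective arcs_of}.
  move=> Y1 Y2; rewrite !inE => /andP[E1 _] /andP[E2 _] eqY.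
  by rewrite -(arcs_ofK E1) eqY arcs_ofK.
rewrite -(card_in_imset inj) -(leq_add2r #|weak|) -cweak.
apply: leq_trans (leq_add (leqnn _) (card_le_shattered weak)) _.
rewrite -cardsUI [_ :&: _](_ : _ = set0) ?cards0 ?addn0; last first.
  apply/setP => X; rewrite inE [RHS]inE; apply/negbTE/negP => /andP[/imsetP[Y + ->]].
  rewrite !inE => /andP[YE conn] sh.
  by have := edge_connected_not_shattered YE conn; rewrite sh.
apply: subset_leq_card; apply/subsetP => X; rewrite inE powersetE.
case/orP => [/imsetP[Y _ ->]|]; last by rewrite inE; apply: shA.
by apply/subsetP => q; rewrite inE => /andP[].
Qed.

Lemma card_arc_strong_le k :
  #|arc_strong_orientations e k| <= #|edge_connected_subgraphs e k|.
Proof.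
rewrite card_strong_subsets; apply: leq_trans (card_le_shattered _) _.
have shA X : shattered (strong_subsets k) X -> X \subset ref_arcs.
  by apply: shattered_subset => Z; rewrite !inE => /andP[].
pose f X := edge @: (ref_arcs :\: X).
have inj : {in [set X | shattered (strong_subsets k) X] &, injective f}.
  have setDDK X : X \subset ref_arcs -> ref_arcs :\: (ref_arcs :\: X) = X.
    by move/setIidPr => XA; rewrite setDDr setDv set0U.
  move=> X1 X2; rewrite !inE => /shA/setDDK X1A /shA/setDDK X2A eqf.
  rewrite -X1A -X2A; congr (_ :\: _); apply/setP.
  have sub X Z : f X = f Z -> {subset ref_arcs :\: X <= ref_arcs :\: Z}.
    move=> fXZ q qX; have /imsetP[r rZ qr] : edge q \in f Z.
      by rewrite -fXZ imset_f.
    suff -> : q = r by [].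
    by apply: edge_inj qr; [move: qX | move: rZ]; rewrite inE => /andP[].
  by move=> q; apply/idP/idP; apply: sub.
rewrite -(card_in_imset inj); apply: subset_leq_card; apply/subsetP => _ /imsetP[X + ->].
rewrite inE => shX; rewrite inE shattered_edge_connected // andbT.
apply/subsetP => _ /imsetP[q + ->]; rewrite inE => /andP[_ qA].
by apply/edgesP; exists q.
Qed.

End Orientations.

Theorem theorem3p8 (T : finType) (e : rel T) (e_sym : symmetric e)
    (e_irr : irreflexive e) (k : nat) :
  #|edge_connected_subgraphs e (2 * k)| <= #|arc_strong_orientations e k|
  /\ #|arc_strong_orientations e k| <= #|edge_connected_subgraphs e k|.
Proof. by split; [apply: card_edge_connected_le | apply: card_arc_strong_le]. Qed.
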